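(* Let $(X,\mathcal{A},\mu)$ be a measure space with $\mu(X)=\infty$ and let $M$ be a maximal ideal in $\mathcal{M}(X,\mathcal{A})$. Then: (1) $M$ is a $Z_{\mu,F}$-ideal if and only if $\mu(Z(f))=\infty$ for all $f\in M$. (2) $M$ is closed in the $m_{\mu,F}$-topology if and only if $\mu(Z(f))=\infty$ for all $f\in M$.
   Context: $X$ is a non-empty set, $\mathcal{A}$ a $\sigma$-algebra on $X$, $\mu:\mathcal{A}\to[0,\infty]$ a measure. $\mathcal{M}(X,\mathcal{A})$ is the commutative ring of all measurable functions $X\to\mathbb{R}$ under pointwise operations, and $Z(f)=\{x\in X: f(x)=0\}$. A $\mu$-finite set is a set $E\in\mathcal{A}$ with $\mu(E)<\infty$. A positive unit of $\mathcal{M}(X,\mathcal{A})$ is a $u\in\mathcal{M}(X,\mathcal{A})$ with $u(x)>0$ for all $x\in X$. The $m_{\mu,F}$-topology on $\mathcal{M}(X,\mathcal{A})$ has as open base the sets $m_{\mu,F}(f,u)=\{g\in\mathcal{M}(X,\mathcal{A}):$ there is a $\mu$-finite set $E$ with $|f(x)-g(x)|<u(x)$ for all $x\in X\setminus E\}$, $f\in\mathcal{M}(X,\mathcal{A})$, $u$ a positive unit. An ideal $I$ of $\mathcal{M}(X,\mathcal{A})$ is a $Z_{\mu,F}$-ideal if whenever $f\in\mathcal{M}(X,\mathcal{A})$ and $g\in I$ satisfy $\mu(\{x\in X: f(x)\neq g(x)\})<\infty$, then $f\in I$; equivalently, whenever $f\in\mathcal{M}(X,\mathcal{A})$ and $\mu(\{x\in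 Z(g): f(x)\neq 0\})<\infty$ for some $g\in I$, then $f\in I$. *)

(* Defs.v *)
From HB Require Import structures.
From mathcomp Require Import all_boot all_order all_algebra.
From mathcomp Require Import ring_quotient.
From mathcomp Require Import all_classical all_reals all_analysis.
From mathcomp Require Import measurable_realfun.
From mathcomp Require Import lra.
Set Implicit Arguments.
Unset Strict Implicit.
Unset Printing Implicit Defensive.
Import Order.TTheory GRing.Theory Num.Theory.
Import numFieldNormedType.Exports.
Local Open Scope classical_set_scope.
Local Open Scope ring_scope.

Section Ideals.
Context (A : comNzRingType).
Implicit Types I J : set A.

(* [idealr_closed] includes [1 \notin I]: ideals are proper, as is usual for
   rings of functions. *)
Definition ideal I : Prop := idealr_closed (mem I).

Definition maximal_ideal I : Prop :=
  ideal I /\ forall J, ideal J -> I `<=` J -> J = I.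

End Ideals.

Section MeasurableFunctions.
Context d (X : measurableType d) (R : realType).
Context (mu : {measure set X -> \bar R}).
Local Notation M := {mfun X >-> R}.
Implicit Types f g : M.

Definition zero_set f : set X := [set x | f x = 0].

Definition mu_finite (E : set X) : Prop := measurable E /\ (mu E < +oo)%E.

Definition positive_unit : set M := [set u | forall x, 0 < u x].

Definition Z_muF_ideal (I : set M) : Prop :=
  ideal I /\
  forall f g, I g -> (mu [set x | f x <> g x] < +oo)%E -> I f.

Definition muF_ball f (u : M) : set M :=
  [set g | exists2 E, mu_finite E & forall x, ~ E x -> `|f x - g x| < u x].

End MeasurableFunctions.

(* mu occurs in the type only so that the m_{mu,F}-topology can be attached to it
   as a canonical structure. *)
Definition muF_space d (X : measurableType d) (R : realType)
  (mu : {measure set X -> \bar R}) : Type := {mfun X >-> R}.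

Section Topology.
Context d (X : measurableType d) (R : realType).
Context (mu : {measure set X -> \bar R}).
Local Notation M := {mfun X >-> R}.
Local Notation T := (muF_space mu).

HB.instance Definition _ := Choice.copy T M.

Definition muF_index : Type := (M * M)%type.
HB.instance Definition _ := Choice.copy muF_index (M * M)%type.
HB.instance Definition _ := isPointed.Build muF_index (0, 0).

Let D : set muF_index := [set p | positive_unit p.2].
Let b (p : muF_index) : set T := muF_ball mu p.1 p.2.

Let b_cover : \bigcup_(i in D) b i = setT.
Proof.
apply/seteqP; split => // f _; exists (f, 1) => /=; first by move=> x /=; exact: ltr01.
exists set0; first by split => //; rewrite measure0.
by move=> x _; rewrite subrr normr0; exact: ltr01.
Qed.

Let muF_ball_sub (f u t v : M) : muF_ball mu f u t ->
  (forall x, `|f x - t x| < u x -> v x <= u x - `|f x - t x|) ->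
  muF_ball mu t v `<=` muF_ball mu f u.
Proof.
move=> [E [mE Efin] ftu] hv k [E' [mE' E'fin] tkv].
exists (E `|` E').
  split; first exact: measurableU.
  apply: (@le_lt_trans _ _ (mu E + mu E')%E); first exact: measureU2.
  by rewrite lte_add_pinfty.
move=> x /= /not_orP[Ex E'x].
have := tkv x E'x; have := hv x (ftu x Ex).
have := ler_distD (t x) (f x) (k x); lra.
Qed.

Let b_join i j t : D i -> D j -> b i t -> b j t ->
  exists k, [/\ D k, b k t & b k `<=` b i `&` b j].
Proof.
case: i j => [f u] [g v]; rewrite /D /b /= => u0 v0 fut gvt.
pose w (p q : M) x := q x - `|p x - t x|.
pose h p q x := if 0 < w p q x then w p q x else 1.
have mw p q : measurable_fun setT (w p q).
  apply: measurable_funB; first exact: measurable_funPT.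
  apply: measurableT_comp => //.
  by apply: measurable_funB; exact: measurable_funPT.
have mh p q : measurable_fun setT (h p q).
  by apply: measurable_fun_ifT => //; exact: measurable_fun_ltr.
have h0 p q x : 0 < h p q x by rewrite /h; case: ifPn => // _; exact: ltr01.
have hle (p q : M) x : `|p x - t x| < q x -> h p q x <= w p q x.
  by rewrite -subr_gt0 /h => ->.
have mm : measurable_fun setT (fun x => Num.min (h f u x) (h g v x)).
  exact: measurable_minr.
pose m : M := HB.pack (fun x => Num.min (h f u x) (h g v x))
  (isMeasurableFun.Build _ _ X R _ mm).
have m0 : positive_unit m by move=> x /=; rewrite lt_min !h0.
exists (t, m); split => //=.
  exists set0; first by split => //; rewrite measure0.
  by move=> x _; rewrite subrr normr0; exact: m0.
by rewrite subsetI; split; apply: muF_ball_sub => // x /hle;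
  apply: le_trans; rewrite /= ge_min lexx ?orbT.
Qed.

HB.instance Definition _ := isBaseTopological.Build T b_cover b_join.

Lemma muF_openE (U : set T) : open U <->
  exists2 F : set (M * M), (forall p, F p -> positive_unit p.2) &
    U = \bigcup_(p in F) muF_ball mu p.1 p.2.
Proof. by split => -[F FD UE]; exists F. Qed.

End Topology.

(* Main.v *)
Require Import Defs.
From mathcomp Require Import all_boot all_order all_algebra.
From mathcomp Require Import all_classical all_reals all_analysis.
From mathcomp Require Import measurable_realfun.
From mathcomp Require Import ring_quotient ring lra.
Set Implicit Arguments.
Unset Strict Implicit.
Unset Printing Implicit Defensive.
Import Order.TTheory GRing.Theory Num.Theory.
Import numFieldNormedType.Exports.
Local Open Scope classical_set_scope.
Local Open Scope ring_scope.

(** A closed ideal is a Z_{mu,F}-ideal, because f lies in the closure of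
    {g} as soon as f and g differ on a mu-finite set only. If a
    Z_{mu,F}-ideal contains some f with mu(Z(f)) < oo, it contains the idempotent
    f * f^-1, which differs from 1 only on Z(f), hence it contains 1.
    Conversely, suppose that every zero set of M has infinite measure. If f and
    g \in M differ exactly on E with mu(E) < oo, then 1 - 1_E, whose zero set is
    E, is not in M, so the idempotent 1_E is in M by maximality, and so is
    f = g + 1_E * (f - g). If f is not in M, write h + k * f = 1 with h \in M; then
    the ball of f of radius 1 / (1 + k^2) misses M, since for g in this ball
    h + k * g = 1 - k * (f - g) vanishes on a mu-finite set only. *)

Section Ideals.
Context (A : comNzRingType).
Implicit Types (I : set A) (a x y : A).

Lemma idealMD I a x y : ideal I -> I x -> I y -> I (a * x + y).
Proof. by case=> _ _ IMD /mem_set Ix /mem_set Iy; exact/set_mem/IMD. Qed.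

Lemma ideal0 I : ideal I -> I 0.
Proof. by case=> /set_mem. Qed.

Lemma idealN1 I : ideal I -> ~ I 1.
Proof. by case=> _ /negP I1 _ /mem_set. Qed.

Lemma idealM I a x : ideal I -> I x -> I (a * x).
Proof.
by move=> iI Ix; rewrite -[a * x]addr0; apply: idealMD => //; exact: ideal0.
Qed.

(** Otherwise the elements [h + k * x] with [h] in [I] form a proper ideal containing both [I] and
    [x], against maximality. *)
Lemma maximal_ideal_coprime I x : maximal_ideal I -> ~ I x ->
  exists h k, I h /\ h + k * x = 1.
Proof.
move=> [iI maxI] nIx; apply: contrapT => ncop.
pose J := [set y | exists h k, I h /\ h + k * x = y].
apply: nIx; suff <- : J = I.
  by exists 0, 1; split; [exact: ideal0|rewrite add0r mul1r].
apply: maxI; last by move=> y Iy; exists y, 0; rewrite mul0r addr0.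
split.
- by apply: mem_set; exists 0, 0; split; [exact: ideal0|rewrite mul0r addr0].
- by apply/negP => /set_mem.
- move=> a _ _ /set_mem[h [k [Ih <-]]] /set_mem[h' [k' [Ih' <-]]].
  apply: mem_set; exists (a * h + h'), (a * k + k').
  by split; [exact: idealMD|ring].
Qed.

(** If [e] is not in [I], multiply [h + k * e = 1] by [1 - e]: the term in [e] dies. *)
Lemma maximal_ideal_idempotent I e : maximal_ideal I -> e * e = e ->
  I e \/ I (1 - e).
Proof.
move=> maxI ee; have [iI _] := maxI.
have [Ie|nIe] := pselect (I e); [by left|right].
have [h [k [Ih hke]]] := maximal_ideal_coprime maxI nIe.
suff -> : 1 - e = (1 - e) * h by exact: idealM.
rewrite (_ : h = 1 - k * e); last by rewrite -hke addrK.
rewrite mulrBr mulr1 mulrCA mulrBl mul1r ee subrr mulr0 subr0.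
by [].
Qed.

End Ideals.

(** Inversion is continuous on the open set [[set~ 0]]; the point 0, where its value is 0 by
    convention, is split off. *)
Lemma measurable_invr (R : realType) :
  measurable_fun [set: R] (@GRing.inv R).
Proof.
rewrite (_ : @GRing.inv R = fun x : R => if x == 0 then 0 else x^-1); last first.
  by apply/funext => x; case: eqVneq => // ->; rewrite invr0.
apply: measurable_fun_if => //; first exact: measurable_fun_eqr.
have -> : [set: R] `&` (fun x : R => x == 0) @^-1` [set false] = [set~ 0].
  apply/seteqP; split => x /=.
    by case=> _ /negbT/eqP.
  by move=> /eqP/negbTE.
apply: open_continuous_measurable_fun.
  by apply: closed_openC; exact: closed_eq.
by move=> x; rewrite inE => /eqP; exact: inv_continuous.
Qed.

Section MeasurableFunctions.
Context d (X : measurableType d) (R : realType).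
Context (mu : {measure set X -> \bar R}).
Local Notation T := {mfun X >-> R}.
Implicit Types (f g u : T) (I : set T).

Lemma mfun_inv_subproof f : (fun x => (f x)^-1) \in @mfun _ _ X R.
Proof.
by rewrite inE; apply: measurableT_comp; first exact: measurable_invr.
Qed.

(** Since [0^-1 = 0], the product [mfun_inv f * f] is the indicator of the complement of
    [zero_set f]. *)
Definition mfun_inv f : T := mfun_Sub (mfun_inv_subproof f).

Lemma mfun_invE f x : mfun_inv f x = (f x)^-1.
Proof. by []. Qed.

Lemma measurable_zero_set f : measurable (zero_set f).
Proof.
rewrite /zero_set -[X in measurable X]setTI.
exact: (measurable_funPT f) measurableT [set 0] _.
Qed.

Lemma measurable_neq f g : measurable [set x | f x <> g x].
Proof.
have mfg : measurable_fun setT (fun x => f x == g x).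
  by apply: measurable_fun_eqr.
have := mfg measurableT [set false] I; rewrite setTI.
congr measurable; apply/seteqP; split => x /=; first by move=> /eqP.
by move=> /eqP/negbTE.
Qed.

Lemma mu_finite_neq f g E : mu_finite mu E ->
  (forall x, ~ E x -> f x = g x) -> (mu [set x | f x <> g x] < +oo)%E.
Proof.
move=> [mE Efin] fgE; apply: le_lt_trans Efin.
apply: le_measure; rewrite ?inE //; first exact: measurable_neq.
by move=> x /= fg; apply: contrapT => /fgE.
Qed.

Lemma muF_ball_center f u : positive_unit u -> muF_ball mu f u f.
Proof.
move=> u0; exists set0; first by split => //; rewrite measure0.
by move=> x _; rewrite subrr normr0; exact: u0.
Qed.

(** The exceptional set of a ball absorbs the points where [g] and [h] differ; hence open sets are
    stable under changes on a [mu]-finite set. *)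
Lemma muF_ball_mod_finite f u g (h : T) : muF_ball mu f u g ->
  (mu [set x | g x <> h x] < +oo)%E -> muF_ball mu f u h.
Proof.
move=> [E [mE Efin] fgu] ghfin; exists (E `|` [set x | g x <> h x]).
  split; first by apply: measurableU => //; exact: measurable_neq.
  apply: (@le_lt_trans _ _ (mu E + mu [set x | g x <> h x])%E).
    by apply: measureU2 => //; exact: measurable_neq.
  by rewrite lte_add_pinfty.
by move=> x /not_orP[Ex /contrapT <-]; exact: fgu.
Qed.

Lemma closed_Z_muF_ideal I : ideal I -> closed (I : set (muF_space mu)) ->
  Z_muF_ideal mu I.
Proof.
move=> iI /closed_openC/muF_openE[F _ IF]; split => // f g Ig fgfin.
apply: contrapT => nIf.
have : (~` I) f by [].
rewrite IF => -[p Fp pf].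
suff : (~` I) g by [].
by rewrite IF; exists p => //; exact: muF_ball_mod_finite fgfin.
Qed.

Lemma Z_muF_ideal_zero_set I f : Z_muF_ideal mu I -> I f ->
  mu (zero_set f) = +oo%E.
Proof.
move=> [iI ZI] If; apply: contrapT => /eqP; rewrite -ltey => Zfin.
apply: (idealN1 iI); apply: (ZI 1 (mfun_inv f * f)); first exact: idealM.
apply: (@mu_finite_neq _ _ (zero_set f)).
  by split => //; exact: measurable_zero_set.
by move=> x /eqP fx; exact/esym/mulVf.
Qed.

Context (M : set T) (maxM : maximal_ideal M).
Context (zero_setM : forall f, M f -> mu (zero_set f) = +oo%E).

Let zero_set_not_finite f E : M f -> mu_finite mu E -> ~ (zero_set f `<=` E).
Proof.
move=> Mf Efin fE; suff : (mu (zero_set f) < +oo)%E.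
  by rewrite zero_setM.
have [mE] := Efin; apply: le_lt_trans; apply: le_measure; rewrite ?inE //.
exact: measurable_zero_set.
Qed.

Lemma maximal_Z_muF_ideal : Z_muF_ideal mu M.
Proof.
have [iM _] := maxM; split => // f g Mg fgfin.
pose E := [set x | f x <> g x].
have mE : measurable E := measurable_neq f g.
have [e eE] : exists e : T, forall x, e x = (x \in E)%:R.
  by exists (indic_mfun E mE) => x; rewrite /= /mindic indicE.
have ee : e * e = e.
  by apply/mfuneqP => x; rewrite mfunM /= !eE -natrM mulnb andbb.
(* The second case is absurd: all zeros of [1 - e] lie in [E]. *)
have [Me|/zero_set_not_finite] := maximal_ideal_idempotent maxM ee.
  suff -> : f = (f - g) * e + g by exact: idealMD.
  apply/mfuneqP => x; rewrite mfunD mfunM mfunB /= eE; have [xE|] := boolP (x \in E).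
    by rewrite mulr1 subrK.
  move=> /negP xE; rewrite mulr0 add0r; apply: contrapT => fg.
  by apply: xE; exact: mem_set.
case/(_ E); first by [].
move=> x; rewrite /zero_set mfunB /= eE.
by have [/set_mem//|_] := boolP (x \in E); rewrite subr0 => /eqP; rewrite oner_eq0.
Qed.

Lemma maximal_muF_closed : closed (M : set (muF_space mu)).
Proof.
have [iM _] := maxM.
rewrite -openC; apply/muF_openE.
(* Taking every ball that misses [M] leaves only one inclusion to prove. *)
exists [set p | positive_unit p.2 /\ muF_ball mu p.1 p.2 `<=` ~` M].
  by move=> p [].
apply/seteqP; split => [f nMf|f [p [_]]]; last exact.
have [h [k [Mh hkf]]] := maximal_ideal_coprime maxM nMf.
have pos x : 0 < 1 + k x * k x.
  by rewrite ltr_pwDl// -expr2 sqr_ge0.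
(* This radius gives [|k x| * u x < 1] everywhere, even where [k x = 0]. *)
pose u := mfun_inv (1 + k * k).
have u0 : positive_unit u by move=> x; rewrite mfun_invE invr_gt0; exact: pos.
exists (f, u); last exact: muF_ball_center.
split => // g [E Efin fgu] Mg.
apply: (@zero_set_not_finite (k * g + h) E) => //.
  exact: idealMD.
move=> x; rewrite /zero_set mfunD mfunM /= => kgh; apply: contrapT => /fgu.
have hkfx : h x + k x * f x = 1 by rewrite -[RHS]/((1 : T) x) -hkf.
rewrite mfun_invE mfunD mfunM /= -div1r ltr_pdivlMr // => fgk.
(* Subtract [k x * g x + h x = 0] from [hkfx]. *)
have kfg : `|k x| * `|f x - g x| = 1.
  by rewrite -normrM (_ : _ * _ = 1) ?normr1//; move: kgh hkfx; lra.
(* By [kfg], [fgk] becomes [|f x - g x| + |k x| < 1], impossible for nonnegative numbers with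
   product 1. *)
move: fgk; rewrite -expr2 -real_normK ?num_real//.
rewrite mulrDr mulr1 expr2 mulrA (mulrC `|_|) kfg mul1r.
have := normr_ge0 (k x); have := normr_ge0 (f x - g x); move: kfg.
clear hkf; nra.
Qed.

End MeasurableFunctions.

Theorem theorem6p37 (d : measure_display) (X : measurableType d) (R : realType)
    (mu : {measure set X -> \bar R}) (M : set {mfun X >-> R})
    (mu_infinite : mu [set: X] = +oo%E) (maxM : maximal_ideal M) :
  (Z_muF_ideal mu M <->
     forall f : {mfun X >-> R}, M f -> mu (zero_set f) = +oo%E) /\
  (closed (M : set (muF_space mu)) <->
     forall f : {mfun X >-> R}, M f -> mu (zero_set f) = +oo%E).
Proof.
split; split => HM.
- by move=> f; exact: Z_muF_ideal_zero_set.
- exact: maximal_Z_muF_ideal.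
- by move=> f; apply/Z_muF_ideal_zero_set/closed_Z_muF_ideal => //; case: maxM.
- exact: maximal_muF_closed.
Qed.
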